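(* Let $A,B$ be finite-dimensional quantum systems, $\mathcal{E}_{B|A}$ a quantum operation (CPTP map) from $A$ to $B$, $\rho_A$ a state of $A$ and $\epsilon\in[0,1]$. Then $$I^{\mathrm{ALL}}_\epsilon(\mathcal{E}_{B|A},\rho_A)=-\log\min_{R_{\tilde AB},\,\lambda}\lambda$$ where the minimum is over $\lambda\in\mathbb{R}$ and Hermitian operators $R_{\tilde AB}$ on $\mathcal{H}_{\tilde A}\otimes\mathcal{H}_B$ subject to $$\mathrm{Tr}_{\tilde A}R_{\tilde AB}\le\lambda\mathbb{1}_B,\qquad \mathrm{Tr}\,R_{\tilde AB}\,\mathcal{E}_{B|A}\Phi_{\tilde AA}\ge1-\epsilon,\qquad R_{\tilde AB}\le\rho_{\tilde A}\otimes\mathbb{1}_B,\qquad R_{\tilde AB}\ge0.$$ Moreover, the bound $\max_{\rho_A\in\mathrm{states}(A)}I^{\mathrm{ALL}}_\epsilon(\mathcal{E}_{B|A},\rho_A)$ is also given by a semidefinite program, namely it equals $-\log$ of the optimal value of the same program with $\rho_{\tilde A}$ treated as an additional variable subject to $\rho_{\tilde A}\ge0$, $\mathrm{Tr}\,\rho_{\tilde A}=1$.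
   Context: Each system has a fixed orthonormal (''classical'') basis $\{|i\rangle\}$; $\mathrm{states}(Q)$ is the set of density operators on $\mathcal{H}_Q$. Identity maps on other systems are omitted. $\tilde A$ is a copy of $A$, $\Phi_{\tilde A A}:=\sum_{i,j}|i\rangle_{\tilde A}|i\rangle_A\langle j|_{\tilde A}\langle j|_A$, $\rho_{\tilde A A}:=\rho_A^{1/2}\Phi_{\tilde AA}\rho_A^{1/2}$, and $\rho_{\tilde A}:=\mathrm{Tr}_A\,\rho_{\tilde AA}$ (the transpose of $\rho_A$ in the classical basis, as an operator on $\tilde A$). For states $\tau^{(0)},\tau^{(1)}$, $\beta^{\mathrm{ALL}}_\epsilon(\tau^{(0)}\|\tau^{(1)}):=\min\{\mathrm{Tr}\,\tau^{(1)}T:\ 0\le T\le \mathbb{1},\ \mathrm{Tr}\,\tau^{(0)}T\ge 1-\epsilon\}$, and $$I^{\mathrm{ALL}}_\epsilon(\mathcal{E}_{B|A},\rho_A):=-\log\max_{\sigma_B\in\mathrm{states}(B)}\beta^{\mathrm{ALL}}_\epsilon(\mathcal{E}_{B|A}\rho_{\tilde AA}\,\|\,\rho_{\tilde A}\otimes\sigma_B),$$ with $-\log0=+\infty$. *)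

(* Defs.v *)
From HB Require Import structures.
From mathcomp Require Import all_boot all_order all_algebra.
From mathcomp Require Import sesquilinear spectral.
From mathcomp Require Import all_classical all_reals all_analysis.
From mathcomp Require Import complex.
From mathcomp Require mxtens.

Set Implicit Arguments.
Unset Strict Implicit.
Unset Printing Implicit Defensive.

Import Order.TTheory GRing.Theory Num.Theory.
Local Open Scope classical_set_scope.
Local Open Scope complex_scope.
Local Open Scope sesquilinear_scope.
Local Open Scope ring_scope.

Definition is_minimum {d} {T : porderType d} (S : set T) (m : T) : Prop :=
  S m /\ lbound S m.

Definition is_maximum {d} {T : porderType d} (S : set T) (m : T) : Prop :=
  S m /\ ubound S m.

(* A system of dimension n is C^n with its standard basis as classical basis,
   C being R[i]. The composite of systems of dimensions k and n (in this order)
   is C^(k * n), with |i>|a> the basis vector mxtens_index (i, a), so that the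
   tensor product of operators is the Kronecker product tensmx. *)

Notation "A *t B" := (mxtens.tensmx A B)
  (at level 40, left associativity, format "A  *t  B") : ring_scope.

Section Operators.
Context {R : realType}.
Local Notation C := R[i].

Definition psd {n} (M : 'M[C]_n) : Prop :=
  M \is hermsymmx /\ forall v : 'cV[C]_n, 0 <= (v ^t* *m M *m v) 0 0.

Definition loewner {n} (M N : 'M[C]_n) : Prop := psd (N - M).

Definition states (n : nat) : set 'M[C]_n := [set M | psd M /\ \tr M = 1].

(* Only used for products of two Hermitian operators, whose trace is real. *)
Definition retr {n} (M : 'M[C]_n) : R := complex.Re (\tr M).

(* The positive square root: spectralmx and spectral_diag provide a spectral
   decomposition M = P^-1 D P with P unitary when M is Hermitian. *)
Definition sqrtmx {n} (M : 'M[C]_n) : 'M[C]_n :=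
  invmx (spectralmx M) *m diag_mx (map_mx sqrtC (spectral_diag M))
    *m spectralmx M.

(* The operator M_ij of the decomposition M = \sum_ij |i><j| (x) M_ij. *)
Definition block {k n} (M : 'M[C]_(k * n)) (i j : 'I_k) : 'M[C]_n :=
  \matrix_(a, b) M (mxtens.mxtens_index (i, a)) (mxtens.mxtens_index (j, b)).

Definition ptrace1 {k n} (M : 'M[C]_(k * n)) : 'M[C]_n := \sum_i block M i i.

Definition ptrace2 {k n} (M : 'M[C]_(k * n)) : 'M[C]_k :=
  \matrix_(i, j) \tr (block M i j).

(* id (x) E, for a linear map E on operators of the second system. *)
Definition id_tens {k n m} (E : 'M[C]_n -> 'M[C]_m)
    (M : 'M[C]_(k * n)) : 'M[C]_(k * m) :=
  \sum_i \sum_j delta_mx i j *t E (block M i j).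

Definition completely_positive {n m} (E : 'M[C]_n -> 'M[C]_m) : Prop :=
  forall (k : nat) (M : 'M[C]_(k * n)), psd M -> psd (id_tens E M).

Definition trace_preserving {n m} (E : 'M[C]_n -> 'M[C]_m) : Prop :=
  forall M : 'M[C]_n, \tr (E M) = \tr M.

Definition cptp {n m} (E : {linear 'M[C]_n -> 'M[C]_m}) : Prop :=
  completely_positive E /\ trace_preserving E.

Definition Phi (n : nat) : 'M[C]_(n * n) :=
  \sum_i \sum_j delta_mx i j *t delta_mx i j.

Definition purification {n} (rho : 'M[C]_n) : 'M[C]_(n * n) :=
  (1%:M *t sqrtmx rho) *m Phi n *m (1%:M *t sqrtmx rho).

Definition rho_copy {n} (rho : 'M[C]_n) : 'M[C]_n := ptrace2 (purification rho).

End Operators.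

Arguments states {R} n.
Arguments Phi {R} n.

Section Bound.
Context {R : realType}.
Local Notation C := R[i].

(* The negated logarithm to base b > 1, equal to +oo at 0. *)
Definition neglog (b x : R) : \bar R := (- (lne x%:E * (ln b)^-1%:E))%E.

(* The set of values is the image of a compact set of tests, nonempty when tau0
   is a state and 0 <= eps, so that the infimum is a minimum. *)
Definition beta_ALL {n} (eps : R) (tau0 tau1 : 'M[C]_n) : R :=
  inf [set retr (tau1 *m T) | T in
        [set T | [/\ loewner 0 T, loewner T 1%:M
                   & 1 - eps <= retr (tau0 *m T)]]].

(* As a function of sigma, beta_ALL is an infimum of linear functions, hence
   upper semicontinuous on the compact set of states, so that the supremum is a
   maximum. *)
Definition I_ALL {nA nB} (b eps : R) (E : 'M[C]_nA -> 'M[C]_nB)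
    (rho : 'M[C]_nA) : \bar R :=
  neglog b (sup [set beta_ALL eps (id_tens E (purification rho))
                                  (rho_copy rho *t sigma)
                | sigma in states nB]).

Definition feasible {nA nB} (eps : R) (E : 'M[C]_nA -> 'M[C]_nB)
    (rhoT : 'M[C]_nA) (X : 'M[C]_(nA * nB)) (lambda : R) : Prop :=
  X \is hermsymmx /\
  [/\ loewner (ptrace1 X) (lambda%:C)%:M,
      1 - eps <= retr (X *m id_tens E (Phi nA)),
      loewner X (rhoT *t 1%:M)
    & loewner 0 X].

Definition sdp_fixed {nA nB} (eps : R) (E : 'M[C]_nA -> 'M[C]_nB)
    (rhoT : 'M[C]_nA) : set R :=
  [set lambda | exists X, feasible eps E rhoT X lambda].

Definition sdp_free {nA nB} (eps : R) (E : 'M[C]_nA -> 'M[C]_nB) : set R :=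
  [set lambda | exists rhoT X,
     [/\ loewner 0 rhoT, \tr rhoT = 1 & feasible eps E rhoT X lambda]].

End Bound.

(* Main.v *)
(* Sandwiching a test T between (S^T (x) 1), S = rho^(1/2), gives an operator X
   with 0 <= X <= rho^T (x) 1, and every such X arises this way, through the
   pseudo-inverse of S. Under this substitution the trace of (rho^T (x) sigma) T
   becomes the trace of sigma (Tr_1 X), so the claim is the minimax identity
   max_sigma min_X Tr sigma (Tr_1 X) = min_X lambda_max (Tr_1 X). If v is below
   the right-hand side, then v 1 is outside the closed convex set of all H with
   H >= Tr_1 X for some X; the difference between the nearest point of that set
   and v 1 is positive semidefinite, and normalised to trace one it is a sigma
   achieving at least v. *)

(* Semidefinite duality usually asks for a strictly feasible point, and there is none when rho is
   singular: no X then lies strictly between 0 and rho^T (x) 1. Separation avoids this. The nearest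
   point is found by minimising over pairs (point, X) in a bounded set, so closedness of the
   projected set is never shown on its own. The channel enters through J = (id (x) E) Phi and the
   identity Tr (G (x) 1) J = Tr G, which makes X = G (x) 1 feasible with lambda = 1 for every state
   G. This one point supplies nonemptiness, the range [0, 1] for lambda and the radius of the
   nearest-point problem. For the maximum over rho, transposition permutes the states, so the copy
   of rho runs over all of them, and -log reverses the order. *)
Require Import Defs.
From HB Require Import structures.
From mathcomp Require Import all_boot all_order all_algebra.
From mathcomp Require Import sesquilinear spectral.
From mathcomp Require Import all_classical all_reals all_analysis.
From mathcomp Require Import complex.
From mathcomp Require mxtens.
From mathcomp Require Import ring lra.

Set Implicit Arguments.
Unset Strict Implicit.
Unset Printing Implicit Defensive.

Import Order.TTheory GRing.Theory Num.Theory numFieldNormedType.Exports.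
Local Open Scope classical_set_scope.
Local Open Scope complex_scope.
Local Open Scope sesquilinear_scope.
Local Open Scope ring_scope.

(** * Positive semidefinite matrices *)

Section Psd.
Context {R : realType}.
Local Notation C := R[i].

Lemma hermP n (M : 'M[C]_n) : M \is hermsymmx <-> M ^t* = M.
Proof.
split; first by move/is_hermitianmxP; rewrite expr0 scale1r => {2}->.
by move=> h; apply/is_hermitianmxP; rewrite expr0 scale1r h.
Qed.

Lemma adjmx_mul m n p (A : 'M[C]_(m, n)) (B : 'M[C]_(n, p)) :
  (A *m B) ^t* = B ^t* *m A ^t*.
Proof. by rewrite trmx_mul map_mxM. Qed.

Lemma adjmxD m n (A B : 'M[C]_(m, n)) : (A + B) ^t* = A ^t* + B ^t*.
Proof. by rewrite linearD map_mxD. Qed.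

Lemma adjmxB m n (A B : 'M[C]_(m, n)) : (A - B) ^t* = A ^t* - B ^t*.
Proof. by rewrite linearB map_mxB. Qed.

Lemma adjmxZ m n (c : R) (A : 'M[C]_(m, n)) :
  (c%:C *: A) ^t* = c%:C *: A ^t*.
Proof. by rewrite linearZ map_mxZ; congr (_ *: _); exact: conjc_real. Qed.

Lemma adjmx_scalar n (c : R) : ((c%:C)%:M : 'M[C]_n) ^t* = (c%:C)%:M.
Proof. by rewrite tr_scalar_mx map_scalar_mx; congr (_%:M); exact: conjc_real. Qed.

Lemma adjmx1 n : (1%:M : 'M[C]_n) ^t* = 1%:M.
Proof. by rewrite trmx1 map_mx1. Qed.

Lemma hermE n (M : 'M[C]_n) i j : M ^t* = M -> M i j = (M j i)^*%C.
Proof. by move=> h; rewrite -{1}h !mxE. Qed.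

Lemma gram_ge0 n (v : 'cV[C]_n) : 0 <= (v ^t* *m v) 0 0.
Proof.
by rewrite mxE sumr_ge0// => i _; rewrite !mxE mulrC mul_conjC_ge0.
Qed.

Lemma psd_herm n (M : 'M[C]_n) : psd M -> M ^t* = M.
Proof. by case=> /hermP. Qed.

Lemma psd_congr m n (A : 'M[C]_(m, n)) (M : 'M[C]_n) :
  psd M -> psd (A *m M *m A ^t*).
Proof.
move=> [/hermP hM M0]; split.
  by apply/hermP; rewrite !adjmx_mul trmxCK hM mulmxA.
move=> v; have := M0 (A ^t* *m v).
by rewrite adjmx_mul trmxCK !mulmxA.
Qed.

Lemma psd0 n : psd (0 : 'M[C]_n).
Proof.
split; first by apply/hermP; rewrite trmx0 map_mx0.
by move=> v; rewrite mulmx0 mul0mx mxE.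
Qed.

Lemma psd1 n : psd (1%:M : 'M[C]_n).
Proof.
by split; [apply/hermP; rewrite adjmx1 | move=> v; rewrite mulmx1 gram_ge0].
Qed.

Lemma psd_gram m n (A : 'M[C]_(m, n)) : psd (A *m A ^t*).
Proof. by rewrite -[X in psd (X *m _)]mulmx1; apply: psd_congr; exact: psd1. Qed.

Lemma psdD n (M N : 'M[C]_n) : psd M -> psd N -> psd (M + N).
Proof.
move=> [/hermP hM M0] [/hermP hN N0]; split.
  by apply/hermP; rewrite adjmxD hM hN.
by move=> v; rewrite mulmxDr mulmxDl mxE addr_ge0.
Qed.

Lemma psdZ n (c : R) (M : 'M[C]_n) : 0 <= c -> psd M -> psd (c%:C *: M).
Proof.
move=> c0 [/hermP hM M0]; split; first by apply/hermP; rewrite adjmxZ hM.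
by move=> v; rewrite -scalemxAr -scalemxAl mxE mulr_ge0// ler0c.
Qed.

Lemma psd_tr n (M : 'M[C]_n) : psd M -> psd M^T.
Proof.
move=> [/hermP hM M0]; split.
  by apply/hermP; rewrite -[in RHS]hM; apply/matrixP => i j; rewrite !mxE.
move=> v; have := M0 (map_mx Num.conj v).
(* A 1 x 1 matrix is its own transpose, which turns the form of M at the conjugate of v into the
   form of M^T at v. *)
have e (N : 'M[C]_1) : N 0 0 = N^T 0 0 by rewrite mxE.
rewrite [X in _ -> 0 <= X]e !trmx_mul !mulmxA; congr (0 <= (_ *m _ *m _) 0 0);
  by apply/matrixP => i j; rewrite !mxE ?conjCK.
Qed.

Lemma herm_Im n (M : 'M[C]_n) i : M ^t* = M -> complex.Im (M i i) = 0 :> R.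
Proof.
move=> hM; have := hermE i i hM; case: (M i i) => x y [] /= hy.
by lra.
Qed.

Lemma psd_diag n (M : 'M[C]_n) i : psd M -> 0 <= M i i.
Proof.
case=> _ /(_ (delta_mx i 0)).
rewrite trmx_delta map_delta_mx -rowE.
by rewrite -colE !mxE.
Qed.

Lemma psd_mxtrace n (M : 'M[C]_n) : psd M -> 0 <= \tr M.
Proof. by move=> hM; apply: sumr_ge0 => i _; exact: psd_diag. Qed.

Lemma psd_of_diag n (d : 'rV[C]_n) :
  (forall i, 0 <= d 0 i) -> psd (diag_mx d).
Proof.
move=> d0; split.
  apply/hermP/matrixP => i j; rewrite !mxE eq_sym; case: eqVneq => [->|_].
    by rewrite !mulr1n; apply: conj_Creal; exact: ger0_real.
  by rewrite !mulr0n rmorph0.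
move=> v; rewrite mul_mx_diag mxE; apply: sumr_ge0 => i _.
by rewrite !mxE mulrAC mulr_ge0// mulrC mul_conjC_ge0.
Qed.

(* A pseudo-inverse rather than an inverse, thanks to the junk value 0^-1 = 0. *)
Definition sqrtpinv n (M : 'M[C]_n) : 'M[C]_n :=
  invmx (spectralmx M) *m diag_mx (map_mx (fun x => (sqrtC x)^-1) (spectral_diag M))
    *m spectralmx M.

(** Conjugation by the unitary [spectralmx M] preserves positivity and leaves the eigenvalues on the
    diagonal. *)
Lemma psd_spectral_ge0 n (M : 'M[C]_n) i : psd M -> 0 <= spectral_diag M 0 i.
Proof.
move=> hM; have /hermP/hermitian_normalmx/orthomx_spectralP eM := psd_herm hM.
have := psd_diag i (psd_congr (spectralmx M) hM).
rewrite {2}eM invmx_unitary ?spectral_unitarymx//.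
rewrite !mulmxA (unitarymxP (spectral_unitarymx M)) mul1mx -mulmxA.
by rewrite (unitarymxP (spectral_unitarymx M)) mulmx1 !mxE eqxx mulr1n.
Qed.

Lemma mul_conj_diag n (P : 'M[C]_n) (d d' : 'rV[C]_n) : P \in unitmx ->
  invmx P *m diag_mx d *m P *m (invmx P *m diag_mx d' *m P) =
  invmx P *m diag_mx (\row_i (d 0 i * d' 0 i)) *m P.
Proof.
move=> uP; rewrite -!mulmxA (mulmxA P (invmx P)) (mulmxV uP) mul1mx.
by rewrite (mulmxA (diag_mx d)) mulmx_diag.
Qed.

Lemma psd_spectral n (M : 'M[C]_n) (d : 'rV[C]_n) : (forall i, 0 <= d 0 i) ->
  psd (invmx (spectralmx M) *m diag_mx d *m spectralmx M).
Proof.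
move=> d0; have uM := spectral_unitarymx M.
rewrite invmx_unitary// -[X in psd (_ *m X)]trmxCK; apply: psd_congr.
exact: psd_of_diag.
Qed.

Lemma psd_sqrtmx n (M : 'M[C]_n) : psd M -> psd (sqrtmx M).
Proof.
by move=> hM; apply: psd_spectral => i; rewrite mxE sqrtC_ge0 psd_spectral_ge0.
Qed.

Lemma psd_sqrtpinv n (M : 'M[C]_n) : psd M -> psd (sqrtpinv M).
Proof.
move=> hM; apply: psd_spectral => i.
by rewrite mxE invr_ge0 sqrtC_ge0 psd_spectral_ge0.
Qed.

Lemma sqrtmx_sqr n (M : 'M[C]_n) : psd M -> sqrtmx M *m sqrtmx M = M.
Proof.
move=> hM; have /hermP/hermitian_normalmx/orthomx_spectralP eM := psd_herm hM.
rewrite [RHS]eM /sqrtmx; move: (spectral_unit M) (spectral_diag M).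
move: (spectralmx M) => P uP d; rewrite (mul_conj_diag _ _ uP).
by congr (invmx P *m diag_mx _ *m P); apply/rowP => i; rewrite !mxE -expr2 sqrtCK.
Qed.

Lemma sqrtpinvC n (M : 'M[C]_n) :
  sqrtmx M *m sqrtpinv M = sqrtpinv M *m sqrtmx M.
Proof.
rewrite /sqrtmx /sqrtpinv; move: (spectral_unit M) (spectral_diag M).
move: (spectralmx M) => P uP d.
rewrite [LHS](mul_conj_diag _ _ uP) [RHS](mul_conj_diag _ _ uP).
by congr (invmx P *m diag_mx _ *m P); apply/rowP => i; rewrite !mxE mulrC.
Qed.

Lemma sqrtpinvK n (M : 'M[C]_n) :
  sqrtmx M *m sqrtpinv M *m sqrtmx M = sqrtmx M.
Proof.
rewrite /sqrtmx /sqrtpinv; move: (spectral_unit M) (spectral_diag M).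
move: (spectralmx M) => P uP d; rewrite 2!(mul_conj_diag _ _ uP).
congr (invmx P *m diag_mx _ *m P); apply/rowP => i; rewrite !mxE.
have [->|x0] := eqVneq (sqrtC (d 0 i)) 0; first by rewrite mulr0.
by rewrite mulfV// mul1r.
Qed.

Lemma sqrtmx_pinv n (M : 'M[C]_n) : psd M -> exists W : 'M[C]_n,
  [/\ psd W, sqrtmx M *m W = W *m sqrtmx M & sqrtmx M *m W *m sqrtmx M = sqrtmx M].
Proof.
move=> hM; exists (sqrtpinv M).
exact: And3 (psd_sqrtpinv hM) (sqrtpinvC M) (sqrtpinvK M).
Qed.

Lemma mxtrace_gram m n (A : 'M[C]_(m, n)) :
  \tr (A *m A ^t*) = \sum_i \sum_j `|A i j| ^+ 2.
Proof.
apply: eq_bigr => i _; rewrite mxE; apply: eq_bigr => j _.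
by rewrite !mxE normCK.
Qed.

Lemma mxtrace_gram_eq0 m n (A : 'M[C]_(m, n)) : \tr (A *m A ^t*) = 0 -> A = 0.
Proof.
rewrite mxtrace_gram => /eqP.
rewrite psumr_eq0; last by move=> i _; apply: sumr_ge0 => j _; exact: exprn_ge0.
move=> /allP A0; apply/matrixP => i j.
have /= := A0 i (mem_index_enum _).
rewrite psumr_eq0; last by move=> k _; exact: exprn_ge0.
by move=> /allP/(_ j (mem_index_enum _))/=; rewrite expf_eq0/= normr_eq0 mxE => /eqP.
Qed.

(** With S the square root of M, cyclicity gives Tr MN = Tr SNS, the trace of a congruence of N. *)
Lemma psd_mxtrace_mul n (M N : 'M[C]_n) : psd M -> psd N -> 0 <= \tr (M *m N).
Proof.
move=> hM hN; rewrite -(sqrtmx_sqr hM) -mulmxA mxtrace_mulC.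
rewrite -[X in \tr (_ *m X)](psd_herm (psd_sqrtmx hM)).
exact/psd_mxtrace/psd_congr.
Qed.

Lemma retr_psd_mul n (M N : 'M[C]_n) : psd M -> psd N -> 0 <= retr (M *m N).
Proof.
by move=> hM hN; have := psd_mxtrace_mul hM hN; rewrite lecE => /andP[].
Qed.

(** Self-duality of the psd cone: testing on the rank-one matrices v v^t* recovers the quadratic
    form. *)
Lemma psd_retr_ge0 n (M : 'M[C]_n) : M ^t* = M ->
  (forall N, psd N -> 0 <= retr (M *m N)) -> psd M.
Proof.
move=> hM M0; split; first exact/hermP.
move=> v; have := M0 _ (psd_gram v).
rewrite /retr mulmxA mxtrace_mulC mulmxA /mxtrace big_ord1 => vMv0.
rewrite lecE vMv0 andbT; apply/eqP/herm_Im.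
by rewrite !adjmx_mul trmxCK hM mulmxA.
Qed.

(** With S the square root of M, the hypothesis is the vanishing of the Gram matrix of A^t* S, hence
    of A^t* S itself. *)
Lemma psd_mul_eq0 m n (M : 'M[C]_n) (A : 'M[C]_(n, m)) :
  psd M -> A ^t* *m M *m A = 0 -> M *m A = 0.
Proof.
move=> hM AMA; have hS := psd_herm (psd_sqrtmx hM).
suff S0 : A ^t* *m sqrtmx M = 0.
  rewrite -(sqrtmx_sqr hM) -mulmxA -[sqrtmx M *m A]trmxCK adjmx_mul hS S0.
  by rewrite trmx0 map_mx0 mulmx0.
apply: mxtrace_gram_eq0.
by rewrite adjmx_mul trmxCK hS mulmxA -(mulmxA _ _ (sqrtmx M)) sqrtmx_sqr// AMA mxtrace0.
Qed.

(** Entries of M = S S^t* are inner products of rows of S, so |M_ij| is at most (M_ii + M_jj) / 2.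
    This is the source of boundedness in the compactness arguments. *)
Lemma psd_entry_bound n (M : 'M[C]_n) i j : psd M ->
  `|M i j| <= \tr M.
Proof.
move=> hM; have hS := psd_herm (psd_sqrtmx hM).
pose S := sqrtmx M; have eM k l : M k l = \sum_p S k p * (S l p)^*%C.
  rewrite -(sqrtmx_sqr hM) -[X in _ *m X]hS mxE; apply: eq_bigr => p _.
  by rewrite !mxE.
have dM k : M k k = \sum_p `|S k p| ^+ 2.
  by rewrite eM; apply: eq_bigr => p _; rewrite normCK.
have tM k : M k k <= \tr M.
  by rewrite /mxtrace (bigD1 k)//= lerDl sumr_ge0// => p _; exact: psd_diag.
have amgm (x y : C) : `|x * y^*%C| <= (`|x| ^+ 2 + `|y| ^+ 2) / 2.
  rewrite normrM norm_conjC ler_pdivlMr//.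
  rewrite -subr_ge0 (_ : _ - _ = (`|x| - `|y|) ^+ 2); last by ring.
  by apply: real_exprn_even_ge0 => //; rewrite realB// normr_real.
rewrite eM (le_trans (ler_norm_sum _ _ _))//.
rewrite (le_trans (ler_sum _ (fun p _ => amgm (S i p) (S j p))))//.
rewrite -mulr_suml big_split/= -!dM ler_pdivrMr// mulr_natr mulr2n.
by rewrite lerD.
Qed.

Lemma psd_trace0 n (M : 'M[C]_n) : psd M -> \tr M = 0 -> M = 0.
Proof.
move=> hM t0; apply/matrixP => i j; have := psd_entry_bound i j hM.
by rewrite t0 normr_le0 => /eqP ->; rewrite mxE.
Qed.

Lemma retrD n (M N : 'M[C]_n) : retr (M + N) = retr M + retr N.
Proof. by rewrite /retr linearD /=; case: (\tr M) => ? ?; case: (\tr N). Qed.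

Lemma retrB n (M N : 'M[C]_n) : retr (M - N) = retr M - retr N.
Proof. by rewrite /retr linearB /=; case: (\tr M) => ? ?; case: (\tr N). Qed.

Lemma retrZ n (c : R) (M : 'M[C]_n) : retr (c%:C *: M) = c * retr M.
Proof.
by rewrite /retr linearZ /=; case: (\tr M) => x y /=; rewrite mul0r subr0.
Qed.

End Psd.

(** * Kronecker products and partial traces *)

Section Tensor.
Context {R : realType}.
Local Notation C := R[i].
Local Notation idx := mxtens.mxtens_index.

Lemma adjmx_tens m n p q (A : 'M[C]_(m, n)) (B : 'M[C]_(p, q)) :
  (A *t B) ^t* = A ^t* *t B ^t*.
Proof. by rewrite mxtens.trmx_tens mxtens.map_mxT. Qed.

Lemma sum_mxtens_index (V : nmodType) k n (F : 'I_(k * n) -> V) :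
  \sum_l F l = \sum_i \sum_a F (idx (i, a)).
Proof.
rewrite pair_bigA/= (reindex (@mxtens.mxtens_index k n))/=; last first.
  exists (@mxtens.mxtens_unindex k n) => l _.
    by rewrite mxtens.mxtens_indexK.
  by rewrite mxtens.mxtens_unindexK.
by apply: eq_bigr => -[i a].
Qed.

Lemma mxtrace_block k n (M : 'M[C]_(k * n)) : \tr M = \sum_i \tr (block M i i).
Proof.
rewrite /mxtrace sum_mxtens_index; apply: eq_bigr => i _.
by apply: eq_bigr => a _; rewrite mxE.
Qed.

Lemma mxtrace_ptrace1 k n (M : 'M[C]_(k * n)) : \tr (ptrace1 M) = \tr M.
Proof. by rewrite mxtrace_block [LHS]linear_sum. Qed.

Lemma block_inj k n (M N : 'M[C]_(k * n)) :
  (forall i j, block M i j = block N i j) -> M = N.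
Proof.
move=> e; apply/matrixP => i j.
case: (mxtens.mxtens_indexP i) => i1 i2; case: (mxtens.mxtens_indexP j) => j1 j2.
by have /matrixP/(_ i2 j2) := e i1 j1; rewrite !mxE.
Qed.

Lemma block_sum_delta k n (N : 'I_k -> 'I_k -> 'M[C]_n) i j :
  block (\sum_p \sum_q delta_mx p q *t N p q) i j = N i j.
Proof.
apply/matrixP => a b; rewrite mxE summxE (bigD1 i)//= summxE (bigD1 j)//=.
rewrite mxtens.tensmxE mxE !eqxx mul1r big1 ?addr0 ?big1 ?addr0//.
  move=> p pi; rewrite summxE big1// => q _.
  by rewrite mxtens.tensmxE mxE eq_sym (negPf pi) mul0r.
move=> q qj.
by rewrite mxtens.tensmxE mxE [j == q]eq_sym (negPf qj) andbF mul0r.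
Qed.

Lemma block_id_tens k n m (F : 'M[C]_n -> 'M[C]_m) (M : 'M[C]_(k * n)) i j :
  block (id_tens F M) i j = F (block M i j).
Proof. exact: block_sum_delta. Qed.

Lemma block_tens1_mul k n (A : 'M[C]_k) (Y : 'M[C]_(k * n)) i j :
  block ((A *t 1%:M) *m Y) i j = \sum_p A i p *: block Y p j.
Proof.
apply/matrixP => a b; rewrite mxE mxE sum_mxtens_index summxE.
apply: eq_bigr => p _; rewrite (bigD1 a)//= big1 ?addr0 => [|d da].
  by rewrite mxtens.tensmxE !mxE eqxx mulr1.
by rewrite mxtens.tensmxE mxE eq_sym (negPf da) mulr0 mul0r.
Qed.

Lemma block_mul_tens1 k n (B : 'M[C]_k) (Y : 'M[C]_(k * n)) i j :
  block (Y *m (B *t 1%:M)) i j = \sum_q B q j *: block Y i q.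
Proof.
apply/matrixP => a b; rewrite mxE mxE sum_mxtens_index summxE.
apply: eq_bigr => q _; rewrite (bigD1 b)//= big1 ?addr0 => [|d db].
  by rewrite mxtens.tensmxE !mxE eqxx mulr1 mulrC.
by rewrite mxtens.tensmxE mxE (negPf db) !mulr0.
Qed.

Lemma block_tens1 k n (A B : 'M[C]_k) (Y : 'M[C]_(k * n)) i j :
  block ((A *t 1%:M) *m Y *m (B *t 1%:M)) i j =
  \sum_p \sum_q (A i p * B q j) *: block Y p q.
Proof.
rewrite block_mul_tens1 exchange_big/=; apply: eq_bigr => q _.
rewrite block_tens1_mul scaler_sumr; apply: eq_bigr => p _.
by rewrite scalerA mulrC.
Qed.

Lemma purification_sum n (rho : 'M[C]_n) :
  purification rho =
  \sum_i \sum_j delta_mx i j *t (sqrtmx rho *m delta_mx i j *m sqrtmx rho).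
Proof.
rewrite /purification /Phi mulmx_sumr mulmx_suml; apply: eq_bigr => i _.
rewrite mulmx_sumr mulmx_suml; apply: eq_bigr => j _.
by rewrite !mxtens.tensmx_mul mul1mx mulmx1.
Qed.

Lemma mul_delta_mx_sum n (S : 'M[C]_n) i j :
  S *m delta_mx i j *m S = \sum_p \sum_q (S p i * S j q) *: delta_mx p q.
Proof.
rewrite [LHS]matrix_sum_delta; apply: eq_bigr => p _; apply: eq_bigr => q _.
congr (_ *: _); rewrite mxE (bigD1 j)//= big1 ?addr0 => [|k kj].
  rewrite mxE (bigD1 i)//= big1 ?addr0 => [|k ki].
    by rewrite mxE !eqxx mulr1.
  by rewrite mxE (negPf ki) mulr0.
rewrite mxE big1 ?mul0r// => l _.
by rewrite mxE (negPf kj) andbF mulr0.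
Qed.

(* (1 (x) S)|Phi> = (S^T (x) 1)|Phi>. *)
Lemma id_tens_purification n m (F : {linear 'M[C]_n -> 'M[C]_m}) (rho : 'M[C]_n) :
  id_tens F (purification rho) =
  ((sqrtmx rho)^T *t 1%:M) *m id_tens F (Phi n) *m ((sqrtmx rho)^T *t 1%:M).
Proof.
apply: block_inj => i j; rewrite block_id_tens block_tens1.
rewrite purification_sum block_sum_delta mul_delta_mx_sum linear_sum.
apply: eq_bigr => p _; rewrite linear_sum; apply: eq_bigr => q _.
by rewrite linearZ/= block_id_tens block_sum_delta !mxE.
Qed.

(** With S the square root of rho, the (i, j) entry is Tr S|i><j|S = Tr |i><j| S^2 = rho_ji. *)
Lemma rho_copyE n (rho : 'M[C]_n) : psd rho -> rho_copy rho = rho^T.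
Proof.
move=> hrho; apply/matrixP => i j; rewrite !mxE purification_sum.
rewrite block_sum_delta -mulmxA mxtrace_mulC -mulmxA sqrtmx_sqr//.
rewrite /mxtrace (bigD1 i)//= big1 ?addr0 => [|k ki]; rewrite mxE (bigD1 j)//=.
  rewrite big1 ?addr0 => [|l lj]; first by rewrite mxE !eqxx mul1r.
  by rewrite mxE (negPf lj) andbF mul0r.
rewrite mxE (negPf ki) mul0r add0r big1// => l _.
by rewrite mxE (negPf ki) mul0r.
Qed.

Lemma mxtrace_id_tens k n m (F : 'M[C]_n -> 'M[C]_m) (M : 'M[C]_(k * n)) :
  trace_preserving F -> \tr (id_tens F M) = \tr M.
Proof.
by move=> tF; rewrite !mxtrace_block; apply: eq_bigr => i _; rewrite block_id_tens tF.
Qed.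

Lemma mxtrace_purification n (rho : 'M[C]_n) : psd rho ->
  \tr (purification rho) = \tr rho.
Proof.
move=> hrho; rewrite -[RHS]mxtrace_tr -rho_copyE// mxtrace_block.
by apply: eq_bigr => i _; rewrite mxE.
Qed.

Lemma mxtrace_1tens k n (s : 'M[C]_n) (X : 'M[C]_(k * n)) :
  \tr ((1%:M *t s) *m X) = \tr (s *m ptrace1 X).
Proof.
rewrite /mxtrace sum_mxtens_index exchange_big/=; apply: eq_bigr => a _.
rewrite mxE; under [RHS]eq_bigr => b _ do rewrite summxE mulr_sumr.
rewrite exchange_big/=; apply: eq_bigr => i _.
rewrite mxE sum_mxtens_index (bigD1 i)//= [X in _ + X]big1 ?addr0 => [|j ji].
  by apply: eq_bigr => b _; rewrite mxtens.tensmxE !mxE eqxx mul1r.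
by apply: big1 => b _; rewrite mxtens.tensmxE mxE eq_sym (negPf ji) !mul0r.
Qed.

Lemma mxtrace_tens_sandwich k n (K : 'M[C]_k) (s : 'M[C]_n) (T : 'M[C]_(k * n)) :
  \tr (((K *m K) *t s) *m T) =
  \tr (s *m ptrace1 ((K *t 1%:M) *m T *m (K *t 1%:M))).
Proof.
rewrite -mxtrace_1tens.
rewrite (_ : (K *m K) *t s = (K *t 1%:M) *m (1%:M *t s) *m (K *t 1%:M)).
  by rewrite -!mulmxA mxtrace_mulC -!mulmxA.
by rewrite !mxtens.tensmx_mul mulmx1 mul1mx mulmx1.
Qed.

Lemma ptrace1D k n (M N : 'M[C]_(k * n)) : ptrace1 (M + N) = ptrace1 M + ptrace1 N.
Proof.
rewrite /ptrace1 -big_split; apply: eq_bigr => i _.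
by apply/matrixP => a b; rewrite !mxE.
Qed.

Lemma ptrace1Z k n (c : C) (M : 'M[C]_(k * n)) : ptrace1 (c *: M) = c *: ptrace1 M.
Proof.
rewrite /ptrace1 scaler_sumr; apply: eq_bigr => i _.
by apply/matrixP => a b; rewrite !mxE.
Qed.

Lemma adjmx_ptrace1 k n (M : 'M[C]_(k * n)) : M ^t* = M -> (ptrace1 M) ^t* = ptrace1 M.
Proof.
move=> hM; apply/matrixP => a b; rewrite !mxE !summxE rmorph_sum.
by apply: eq_bigr => i _; rewrite !mxE [in RHS](hermE _ _ hM).
Qed.

Lemma ptrace1_tens1 k n (G : 'M[C]_k) :
  ptrace1 (G *t (1%:M : 'M[C]_n)) = (\tr G)%:M.
Proof.
apply/matrixP => a b; rewrite summxE mxE.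
under eq_bigr => i _ do rewrite mxE mxtens.tensmxE mxE.
by rewrite -mulr_suml mulr_natr.
Qed.

(** The product is the Gram matrix of the tensor product of the square roots. *)
Lemma psd_tens k n (A : 'M[C]_k) (B : 'M[C]_n) : psd A -> psd B -> psd (A *t B).
Proof.
move=> hA hB; rewrite -(sqrtmx_sqr hA) -(sqrtmx_sqr hB).
rewrite -{2}(psd_herm (psd_sqrtmx hA)) -{2}(psd_herm (psd_sqrtmx hB)).
by rewrite -mxtens.tensmx_mul -adjmx_tens; exact: psd_gram.
Qed.

(** The partial trace is adjoint to the positive map N |-> 1 (x) N, and the psd cone is
    self-dual. *)
Lemma psd_ptrace1 k n (X : 'M[C]_(k * n)) : psd X -> psd (ptrace1 X).
Proof.
move=> hX; apply: psd_retr_ge0; first exact/adjmx_ptrace1/psd_herm.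
move=> N hN; rewrite /retr mxtrace_mulC -mxtrace_1tens.
exact: retr_psd_mul (psd_tens (psd1 _) hN) hX.
Qed.

End Tensor.

(** * Minimisation over closed bounded sets of Hermitian matrices *)

Section Compactness.
Context {R : realType}.
Local Notation C := R[i].

(** Continuity is stated in real coordinates, so that every topological fact below concerns
    real-valued maps. *)
Definition ccont (T : topologicalType) (F : T -> C) : Prop :=
  continuous (fun x => complex.Re (F x) : R) /\
  continuous (fun x => complex.Im (F x) : R).

Section Continuity.
Context {T : topologicalType}.
Implicit Types F : T -> C.

Lemma continuous_addr (f g : T -> R) : continuous f -> continuous g ->
  continuous (fun x => f x + g x).
Proof. by move=> cf cg x; apply: cvgD; [exact: cf | exact: cg]. Qed.

Lemma continuous_subr (f g : T -> R) : continuous f -> continuous g ->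
  continuous (fun x => f x - g x).
Proof. by move=> cf cg x; apply: cvgB; [exact: cf | exact: cg]. Qed.

Lemma ccont_cst (c : C) : ccont (fun _ : T => c).
Proof. by split => x; exact: cst_continuous. Qed.

Lemma ccontD F1 F2 : ccont F1 -> ccont F2 -> ccont (fun x => F1 x + F2 x).
Proof.
move=> [r1 i1] [r2 i2]; split => x.
  rewrite (_ : (fun _ => _) = (fun x => complex.Re (F1 x) + complex.Re (F2 x))).
    by apply: cvgD; [exact: r1 | exact: r2].
  by apply/funext => y; case: (F1 y) => ? ?; case: (F2 y).
rewrite (_ : (fun _ => _) = (fun x => complex.Im (F1 x) + complex.Im (F2 x))).
  by apply: cvgD; [exact: i1 | exact: i2].
by apply/funext => y; case: (F1 y) => ? ?; case: (F2 y).
Qed.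

Lemma ccontM F1 F2 : ccont F1 -> ccont F2 -> ccont (fun x => F1 x * F2 x).
Proof.
move=> [r1 i1] [r2 i2]; split => x.
  rewrite (_ : (fun _ => _) = (fun x => complex.Re (F1 x) * complex.Re (F2 x) -
     complex.Im (F1 x) * complex.Im (F2 x))).
    by apply: cvgB; apply: cvgM; [exact: r1|exact: r2|exact: i1|exact: i2].
  by apply/funext => y; case: (F1 y) => ? ?; case: (F2 y).
rewrite (_ : (fun _ => _) = (fun x => complex.Re (F1 x) * complex.Im (F2 x) +
     complex.Im (F1 x) * complex.Re (F2 x))).
  by apply: cvgD; apply: cvgM; [exact: r1|exact: i2|exact: i1|exact: r2].
by apply/funext => y; case: (F1 y) => ? ?; case: (F2 y).
Qed.

Lemma ccont_sum (I : Type) (s : seq I) (F : I -> T -> C) :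
  (forall i, ccont (F i)) -> ccont (fun x => \sum_(i <- s) F i x).
Proof.
move=> cF; elim: s => [|i s IH].
  rewrite (_ : (fun _ => _) = (fun=> 0)); first exact: ccont_cst.
  by apply/funext => x; rewrite big_nil.
rewrite (_ : (fun _ => _) = (fun x => F i x + \sum_(j <- s) F j x)).
  exact: ccontD.
by apply/funext => x; rewrite big_cons.
Qed.

Definition mxcont m n (M : T -> 'M[C]_(m, n)) : Prop :=
  forall i j, ccont (fun x => M x i j).

Lemma mxcont_cst m n (A : 'M[C]_(m, n)) : mxcont (fun=> A).
Proof. by move=> i j; exact: ccont_cst. Qed.

Lemma mxcontD m n (M N : T -> 'M[C]_(m, n)) :
  mxcont M -> mxcont N -> mxcont (fun x => M x + N x).
Proof.
move=> cM cN i j; rewrite (_ : (fun _ => _) = (fun x => M x i j + N x i j)).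
  exact: ccontD.
by apply/funext => x; rewrite mxE.
Qed.

Lemma mxcontM m n p (M : T -> 'M[C]_(m, n)) (N : T -> 'M[C]_(n, p)) :
  mxcont M -> mxcont N -> mxcont (fun x => M x *m N x).
Proof.
move=> cM cN i j; rewrite (_ : (fun _ => _) = (fun x => \sum_k M x i k * N x k j)).
  by apply: ccont_sum => k; exact: ccontM.
by apply/funext => x; rewrite mxE.
Qed.

Lemma mxcontN m n (M : T -> 'M[C]_(m, n)) : mxcont M -> mxcont (fun x => - M x).
Proof.
move=> cM i j; rewrite (_ : (fun _ => _) = (fun x => (-1) * M x i j)).
  by apply: ccontM => //; exact: ccont_cst.
by apply/funext => x; rewrite mxE mulN1r.
Qed.

Lemma mxcontB m n (M N : T -> 'M[C]_(m, n)) :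
  mxcont M -> mxcont N -> mxcont (fun x => M x - N x).
Proof. by move=> cM cN; apply: mxcontD => //; exact: mxcontN. Qed.

Lemma mxcont_ptrace1 k n (M : T -> 'M[C]_(k * n)) :
  mxcont M -> mxcont (fun x => ptrace1 (M x)).
Proof.
move=> cM a b; rewrite (_ : (fun _ => _) = (fun x => \sum_i M x
  (mxtens.mxtens_index (i, a)) (mxtens.mxtens_index (i, b)))).
  by apply: ccont_sum => i; exact: cM.
by apply/funext => x; rewrite summxE; apply: eq_bigr => i _; rewrite mxE.
Qed.

Lemma mxcont_tens m n p q (A : T -> 'M[C]_(m, n)) (B : 'M[C]_(p, q)) :
  mxcont A -> mxcont (fun x => A x *t B).
Proof.
move=> cA i j; rewrite (_ : (fun _ => _) = (fun x => A x
  (mxtens.mxtens_unindex i).1 (mxtens.mxtens_unindex j).1 *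
  B (mxtens.mxtens_unindex i).2 (mxtens.mxtens_unindex j).2)).
  by apply: ccontM; [exact: cA | exact: ccont_cst].
by apply/funext => x; rewrite mxE.
Qed.

Lemma mxcont_scalar n (F : T -> C) :
  ccont F -> mxcont (fun x => (F x)%:M : 'M[C]_n).
Proof.
move=> cF i j; rewrite (_ : (fun _ => _) = (fun x => F x * (i == j)%:R)).
  by apply: ccontM => //; exact: ccont_cst.
by apply/funext => x; rewrite mxE mulr_natr.
Qed.

Lemma ccont_mxtrace n (M : T -> 'M[C]_n) : mxcont M -> ccont (fun x => \tr (M x)).
Proof. by move=> cM; apply: ccont_sum => i; exact: cM. Qed.

Lemma continuous_retr n (M : T -> 'M[C]_n) :
  mxcont M -> continuous (fun x => retr (M x)).
Proof. by move=> /ccont_mxtrace[]. Qed.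

Lemma closed_ler (f g : T -> R) : continuous f -> continuous g ->
  closed [set x | f x <= g x].
Proof.
move=> cf cg; rewrite (_ : [set x | _] = (g \- f) @^-1` [set y | 0 <= y]).
  apply: closed_comp; last exact: closed_ge.
  by move=> x _; apply: cvgB; [exact: cg | exact: cf].
by apply/seteqP; split => x /=; rewrite subr_ge0.
Qed.

Lemma closed_eqr (f g : T -> R) : continuous f -> continuous g ->
  closed [set x | f x = g x].
Proof.
move=> cf cg.
rewrite (_ : [set x | _] = [set x | f x <= g x] `&` [set x | g x <= f x]).
  by apply: closedI; exact: closed_ler.
apply/seteqP; split => x /=; first by move=> ->.
by move=> [fg gf]; apply/eqP; rewrite eq_le fg.
Qed.

Lemma closed_ccont_eq (F G : T -> C) : ccont F -> ccont G ->
  closed [set x | F x = G x].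
Proof.
move=> [rF iF] [rG iG].
rewrite (_ : [set x | _] = [set x | complex.Re (F x) = complex.Re (G x)] `&`
  [set x | complex.Im (F x) = complex.Im (G x)]).
  by apply: closedI; exact: closed_eqr.
apply/seteqP; split => x /=; first by move=> ->.
by case: (F x) => ? ?; case: (G x) => ? ? /= [-> ->].
Qed.

Lemma closed_forall (I : Type) (S : I -> T -> Prop) :
  (forall i, closed [set x | S i x]) -> closed [set x | forall i, S i x].
Proof.
move=> cS; rewrite (_ : [set x | _] = \bigcap_(i in setT) [set x | S i x]).
  by apply: closed_bigI => i _; exact: cS.
by apply/seteqP; split => x /= h i; [move=> _|]; exact: h.
Qed.

Lemma closed_mxcont_eq m n (M N : T -> 'M[C]_(m, n)) : mxcont M -> mxcont N ->
  closed [set x | M x = N x].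
Proof.
move=> cM cN; rewrite (_ : [set x | _] = [set x | forall i j, M x i j = N x i j]).
  apply: closed_forall => i; apply: closed_forall => j.
  exact: closed_ccont_eq.
by apply/seteqP; split => x /=; [move=> -> | move=> ?; exact/matrixP].
Qed.

(** An intersection over v of closed conditions: for a Hermitian matrix the quadratic form is real,
    so only its real part has to be constrained. *)
Lemma closed_psd n (M : T -> 'M[C]_n) : (forall x, (M x) ^t* = M x) -> mxcont M ->
  closed [set x | psd (M x)].
Proof.
move=> hM cM.
rewrite (_ : [set x | _] = [set x | forall v : 'cV[C]_n,
   0 <= complex.Re ((v ^t* *m M x *m v) 0 0)]).
  apply: closed_forall => v.
  apply: (@closed_ler (fun=> 0)); first by move=> x; exact: cst_continuous.
  have := mxcontM (mxcontM (mxcont_cst (v ^t*)) cM) (mxcont_cst v).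
  by move=> /(_ 0 0) [].
apply/seteqP; split => x /=.
  by move=> [_ M0] v; have := M0 v; rewrite lecE => /andP[].
move=> M0; split; first exact/hermP.
move=> v; rewrite lecE M0 andbT; apply/eqP/herm_Im.
by rewrite !adjmx_mul trmxCK hM mulmxA.
Qed.

End Continuity.

(** The extreme value theorem on a closed part of a cube, compact by Tychonoff for pointwise
    convergence. *)
Lemma box_min (I : eqType) (S : set {ptws I -> R}) (f : {ptws I -> R} -> R) (r : R) :
  closed S -> S !=set0 -> (forall x, S x -> forall i, `|x i| <= r) ->
  continuous f -> exists2 x, S x & forall y, S y -> f x <= f y.
Proof.
move=> cS S0 bS cf.
have cB : compact [set x : {ptws I -> R} | forall i, `[- r, r]%classic (x i)].
  exact: (@tychonoff I (fun=> R) (fun=> `[- r, r]%classic)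
    (fun=> @segment_compact _ _ _)).
have kS : compact S.
  apply: (subclosed_compact cS cB) => x Sx i /=.
  by rewrite in_itv/= -ler_norml; exact: bS.
have [x xS xmin] := compact_EVT_min S0 kS (continuous_subspaceT cf).
by exists x; [exact/set_mem | move=> y Sy; apply: xmin; exact/mem_set].
Qed.

(** A bijective coding of Hermitian matrices by arbitrary real functions: the symmetric part of X
    gives the real parts, the antisymmetric part the imaginary ones, and (Re + Im) / 2 decodes.
    Hermiticity thus costs no constraint. *)
Definition hermx n (X : 'I_n * 'I_n -> R) : 'M[C]_n :=
  \matrix_(i, j) ((X (i, j) + X (j, i)) +i* (X (i, j) - X (j, i)))%C.

Lemma adjmx_hermx n (X : 'I_n * 'I_n -> R) : (hermx X) ^t* = hermx X.
Proof.
apply/matrixP => i j; rewrite !mxE.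
by rewrite -[LHS]/(conjc _) /= [_ + X (j, i)]addrC opprB.
Qed.

Lemma hermxP n (M : 'M[C]_n) : M ^t* = M ->
  M = hermx (fun ij => (complex.Re (M ij.1 ij.2) + complex.Im (M ij.1 ij.2)) / 2).
Proof.
move=> hM; apply/matrixP => i j; rewrite !mxE/=.
rewrite (hermE j i hM); case: (M i j) => x y /=.
by congr (_ +i* _)%C; lra.
Qed.

Lemma hermx_entry n (X : 'I_n * 'I_n -> R) i j :
  X (i, j) = (complex.Re (hermx X i j) + complex.Im (hermx X i j)) / 2.
Proof. by rewrite mxE/=; lra. Qed.

Lemma norm_ReIm (z : C) (r : R) : `|z| <= r%:C ->
  `|(complex.Re z + complex.Im z) / 2| <= r.
Proof.
case: z => x y; rewrite normc_def/= lecR => h.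
have r0 : 0 <= r by rewrite (le_trans _ h)// sqrtr_ge0.
have : x ^+ 2 + y ^+ 2 <= r ^+ 2.
  by rewrite -(sqr_sqrtr (addr_ge0 (sqr_ge0 x) (sqr_ge0 y))) lerXn2r ?nnegrE ?sqrtr_ge0.
move=> {}h; rewrite -(ger0_norm r0) -ler_sqr ?nnegrE// ?normr_ge0//.
rewrite !real_normK ?num_real//; nra.
Qed.

(** Closedness is expressed by pulling back along all continuous Hermitian families, which avoids
    choosing a topology on complex matrices. *)
Definition mxclosed3 a b c (S : 'M[C]_a -> 'M[C]_b -> 'M[C]_c -> Prop) :=
  forall (T : topologicalType) (G : T -> 'M[C]_a) (X : T -> 'M[C]_b) (Z : T -> 'M[C]_c),
    mxcont G -> mxcont X -> mxcont Z ->
    (forall x, (G x) ^t* = G x) -> (forall x, (X x) ^t* = X x) ->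
    (forall x, (Z x) ^t* = Z x) -> closed [set x | S (G x) (X x) (Z x)].

Lemma mxcont_hermx (I : eqType) n (e : 'I_n * 'I_n -> I) :
  mxcont (fun x : {ptws I -> R} => hermx (fun p => x (e p))).
Proof.
have c p : continuous (fun x : {ptws I -> R} => x p).
  exact: (@proj_continuous I (fun=> R) p).
move=> i j; split.
  rewrite (_ : (fun _ => _) = (fun x : {ptws I -> R} => x (e (i, j)) + x (e (j, i)))).
    exact: continuous_addr (c _) (c _).
  by apply/funext => y; rewrite mxE.
rewrite (_ : (fun _ => _) = (fun x : {ptws I -> R} => x (e (i, j)) - x (e (j, i)))).
  exact: continuous_subr (c _) (c _).
by apply/funext => y; rewrite mxE.
Qed.

(** Three slots serve both uses: G is the state, X the sandwiched test, and Z carries the objective,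
    namely lambda as a 1 x 1 matrix or the displacement from v 1. *)
Lemma herm_min a b c (S : 'M[C]_a -> 'M[C]_b -> 'M[C]_c -> Prop)
    (f : 'M[C]_c -> R) (r : R) :
  mxclosed3 S ->
  (forall (T : topologicalType) (Z : T -> 'M[C]_c), mxcont Z -> continuous (f \o Z)) ->
  (forall G X Z, S G X Z -> [/\ G ^t* = G, X ^t* = X & Z ^t* = Z]) ->
  (forall G X Z, S G X Z -> [/\ forall i j, `|G i j| <= r%:C,
     forall i j, `|X i j| <= r%:C & forall i j, `|Z i j| <= r%:C]) ->
  (exists G X Z, S G X Z) ->
  exists G X Z, S G X Z /\ forall G' X' Z', S G' X' Z' -> f Z <= f Z'.
Proof.
move=> cS cf hS bS [G0 [X0 [Z0 S0]]].
(* A triple becomes one real function on the disjoint union of the three index sets. *)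
pose I : eqType := ('I_a * 'I_a + 'I_b * 'I_b + 'I_c * 'I_c)%type.
pose g (x : {ptws I -> R}) := hermx (fun p => x (inl (inl p))) : 'M[C]_a.
pose h (x : {ptws I -> R}) := hermx (fun p => x (inl (inr p))) : 'M[C]_b.
pose k (x : {ptws I -> R}) := hermx (fun p => x (inr p)) : 'M[C]_c.
have cod G X Z : S G X Z -> exists x, [/\ g x = G, h x = X & k x = Z].
  move=> /hS[/hermxP eG /hermxP eX /hermxP eZ].
  pose u m (M : 'M[C]_m) (ij : 'I_m * 'I_m) : R :=
    (complex.Re (M ij.1 ij.2) + complex.Im (M ij.1 ij.2)) / 2.
  by exists (fun i : I => match i with inl (inl p) => u _ G p
    | inl (inr p) => u _ X p | inr p => u _ Z p end).
have [] := @box_min I [set x | S (g x) (h x) (k x)] (f \o k) r.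
- by apply: cS => [|||x|x|x]; rewrite ?adjmx_hermx//; exact: mxcont_hermx.
- by have [x [ex ey ez]] := cod _ _ _ S0; exists x; rewrite /= ex ey ez.
- move=> x /bS[b1 b2 b3] [[[i j]|[i j]]|[i j]].
  + rewrite (hermx_entry (fun p => x (inl (inl p)))); exact/norm_ReIm/b1.
  + rewrite (hermx_entry (fun p => x (inl (inr p)))); exact/norm_ReIm/b2.
  + rewrite (hermx_entry (fun p => x (inr p))); exact/norm_ReIm/b3.
- by apply: cf; exact: mxcont_hermx.
move=> x Sx xmin; exists (g x), (h x), (k x); split=> // G X Z SG.
have [y [ex ey ez]] := cod _ _ _ SG.
by rewrite -ez; apply: (xmin y); rewrite /= ex ey ez.
Qed.

End Compactness.

(** * The semidefinite program *)

(** Sandwiching the Choi operator with the transposed square root of G^T gives the channel output on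
    the purification of G^T, and the channel preserves its trace. *)
Lemma mxtrace_tens_choi (R : realType) (nA nB : nat)
    (E : {linear 'M[R[i]]_nA -> 'M[R[i]]_nB}) (G : 'M[R[i]]_nA) :
  trace_preserving E -> psd G -> \tr ((G *t 1%:M) *m id_tens E (Phi nA)) = \tr G.
Proof.
move=> E_tp hG; have hr := psd_tr hG; rewrite -[RHS]mxtrace_tr.
rewrite -(mxtrace_purification hr) -(mxtrace_id_tens _ E_tp) id_tens_purification.
rewrite [RHS]mxtrace_mulC mulmxA mxtens.tensmx_mul -trmx_mul (sqrtmx_sqr hr).
by rewrite trmxK mulmx1.
Qed.

Section Program.
Context {R : realType} {nA nB : nat}.
Local Notation C := R[i].
Variable J : 'M[C]_(nA * nB).
Hypothesis mxtraceJ : forall G : 'M[C]_nA, psd G -> \tr ((G *t 1%:M) *m J) = \tr G.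
Hypothesis nB_gt0 : (0 < nB)%N.
Variable eps : R.
Hypothesis eps_ge0 : 0 <= eps.

(* The image of the tests T under T |-> (S^T (x) 1) T (S^T (x) 1), S = sqrt(G^T). *)
Definition test_image (G : 'M[C]_nA) (X : 'M[C]_(nA * nB)) : Prop :=
  [/\ psd X, psd (G *t 1%:M - X) & 1 - eps <= retr (X *m J)].

Definition program G X (l : R) : Prop :=
  test_image G X /\ psd ((l%:C)%:M - ptrace1 X).

(** This is the image of the trivial test T = 1, which always accepts. *)
Lemma test_image_tens1 G : states nA G -> test_image G (G *t 1%:M).
Proof.
move=> [hG tG]; split.
- by apply: psd_tens => //; exact: psd1.
- by rewrite subrr; exact: psd0.
- by rewrite /retr mxtraceJ// tG /= gerBl.
Qed.

Lemma program_tens1 G : states nA G -> program G (G *t 1%:M) 1.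
Proof.
move=> hG; split; first exact: test_image_tens1.
by rewrite ptrace1_tens1; case: hG => _ ->; rewrite subrr; exact: psd0.
Qed.

(** Taking traces in the constraint gives nB lambda >= Tr X >= 0. *)
Lemma program_ge0 G X lambda : program G X lambda -> 0 <= lambda.
Proof.
move=> [[hX _ _] hl].
have := psd_mxtrace (psdD hl (psd_ptrace1 hX)).
rewrite subrK mxtrace_scalar -mulr_natl pmulr_rge0 ?ltr0n// ler0c //.
Qed.

(** The constant is Tr (G (x) 1) = nB, which dominates Tr X. *)
Lemma test_image_bound G X i j : \tr G = 1 -> test_image G X ->
  `|X i j| <= (nB%:R)%:C.
Proof.
move=> tG [hX hGX _]; rewrite (le_trans (psd_entry_bound i j hX))//.
have := psd_mxtrace hGX; rewrite linearB /= subr_ge0 => /le_trans; apply.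
by rewrite -mxtrace_ptrace1 ptrace1_tens1 tG mxtrace_scalar rmorph_nat.
Qed.

Lemma closed_test_image (T : topologicalType) (G : T -> 'M[C]_nA)
    (X : T -> 'M[C]_(nA * nB)) : mxcont G -> mxcont X ->
  (forall x, (G x) ^t* = G x) -> (forall x, (X x) ^t* = X x) ->
  closed [set x | test_image (G x) (X x)].
Proof.
move=> cG cX hG hX.
rewrite (_ : [set x | _] = [set x | psd (X x)] `&`
  [set x | psd (G x *t 1%:M - X x)] `&` [set x | 1 - eps <= retr (X x *m J)]).
  apply: closedI; [apply: closedI|].
  - exact: closed_psd.
  - apply: closed_psd => [x|]; first by rewrite adjmxB adjmx_tens adjmx1 hG hX.
    by apply: mxcontB => //; exact: mxcont_tens.
  - apply: (@closed_ler _ _ (fun=> 1 - eps)); first by move=> x; exact: cst_continuous.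
    by apply: continuous_retr; apply: mxcontM => //; exact: mxcont_cst.
apply/seteqP; split => x; first by move=> [h1 h2 h3]; exact: conj (conj h1 h2) h3.
by move=> [[h1 h2] h3]; exact: And3 h1 h2 h3.
Qed.

Definition mxclosed n (P : set 'M[C]_n) : Prop :=
  forall (T : topologicalType) (G : T -> 'M[C]_n), mxcont G ->
    (forall x, (G x) ^t* = G x) -> closed [set x | P (G x)].

(** P is a singleton for the program with fixed state and the set of all states for the free one. *)
Lemma sdp_minimum (P : set 'M[C]_nA) : mxclosed P -> P `<=` states nA ->
  P !=set0 ->
  exists lambda, is_minimum
    [set l | exists G X, P G /\ program G X l] lambda.
Proof.
move=> cP sP [G0 PG0].
(* Restricting lambda to [0, 1] makes the set bounded and loses nothing: feasible values are
   nonnegative and the value 1 is feasible. *)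
pose S G X (Z : 'M[C]_1) := [/\ P G, Z ^t* = Z, 0 <= complex.Re (Z 0 0),
  complex.Re (Z 0 0) <= 1 & program G X (complex.Re (Z 0 0))].
pose f (Z : 'M[C]_1) : R := complex.Re (Z 0 0).
have fs (l : R) : f (l%:C)%:M = l by rewrite /f mxE.
have [] := @herm_min _ _ _ _ S f (nB%:R + 1).
- move=> T G X Z cG cX cZ hG hX hZ.
  have cf : continuous (fun x => f (Z x)) by have [] := cZ 0 0.
  rewrite (_ : [set x | _] = [set x | P (G x)] `&` [set x | 0 <= f (Z x)] `&`
    [set x | f (Z x) <= 1] `&` [set x | test_image (G x) (X x)] `&`
    [set x | psd (((f (Z x))%:C)%:M - ptrace1 (X x))]).
    apply: closedI; [apply: closedI; [apply: closedI; [apply: closedI|]|]|].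
    + exact: cP.
    + by apply: (@closed_ler _ _ (fun=> 0)) => // x; exact: cst_continuous.
    + by apply: (@closed_ler _ _ _ (fun=> 1)) => // x; exact: cst_continuous.
    + exact: closed_test_image.
    + apply: closed_psd => [x|].
        by rewrite adjmxB adjmx_scalar adjmx_ptrace1.
      apply: mxcontB; last exact: mxcont_ptrace1.
      by apply: mxcont_scalar; split => // x; exact: cst_continuous.
  apply/seteqP; split => x.
    by move=> [h1 h2 h3 h4 [h5 h6]]; exact: conj (conj (conj (conj h1 h3) h4) h5) h6.
  by move=> [[[[h1 h3] h4] h5] h6]; exact: And5 h1 (hZ x) h3 h4 (conj h5 h6).
- by move=> T Z /(_ 0 0)[].
- by move=> G X Z [/sP[hG _] hZ _ _ [[hX _ _] _]]; split=> //; exact: psd_herm.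
- have n0 : 0 <= nB%:R :> R by rewrite ler0n.
  move=> G X Z [/sP[hG tG] hZ Z0 Z1 [hX _]]; split=> i j.
  + rewrite (le_trans (psd_entry_bound i j hG))// tG.
    by rewrite -[1]/(1%:C) lecR lerDr.
  + by rewrite (le_trans (test_image_bound i j tG hX))// lecR lerDl.
  + rewrite !ord1; have := herm_Im 0 hZ; move: Z0 Z1.
    case: (Z 0 0) => x y /= x0 x1 ->.
    rewrite normc_def/= expr0n addr0 sqrtr_sqr lecR ger0_norm//.
    by rewrite (le_trans x1)// lerDr.
- exists G0, (G0 *t 1%:M), (1%:C)%:M.
  have := fs 1; rewrite /f => e; split=> //.
  + exact: adjmx_scalar.
  + by rewrite e.
  + by rewrite e.
  + by rewrite e; exact/program_tens1/sP.
move=> G [X [Z [[PG hZ Z0 Z1 fG] minZ]]]; exists (f Z); split; first by exists G, X.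
move=> l [G' [X' [PG' fG']]].
have [l1|/ltW l1] := leP l 1; last exact: le_trans Z1 l1.
rewrite -(fs l); apply: (minZ G' X'); have := fs l; rewrite /S /f => ->.
exact: And5 PG' (adjmx_scalar _ _) (program_ge0 fG') l1 fG'.
Qed.

(** Tr Z^2 is the sum of the squared moduli of the entries; x <= x^2 + 1 removes the square. *)
Lemma herm_entry_bound n (Z : 'M[C]_n) i j : Z ^t* = Z ->
  `|Z i j| <= (retr (Z *m Z) + 1)%:C.
Proof.
move=> hZ; have : `|Z i j| ^+ 2 <= \tr (Z *m Z).
  rewrite -[in X in \tr (_ *m X)]hZ mxtrace_gram (bigD1 i)//= (bigD1 j)//=.
  rewrite -addrA lerDl addr_ge0// sumr_ge0// => k _; rewrite ?exprn_ge0//.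
  by rewrite sumr_ge0// => l _; rewrite exprn_ge0.
rewrite normc_def; set x := Num.sqrt _; have x0 : 0 <= x by exact: sqrtr_ge0.
rewrite -rmorphXn lecE /= => /andP[_]; rewrite -/(retr _) lecR => h.
nra.
Qed.

(* Z is the projection of v 1_B onto the up-closure of [ptrace1 @` test_image G],
   minus v 1_B: first-order optimality makes it a separating functional. *)
Lemma separating_state G (v : R) : states nA G ->
  (forall X, ~ program G X v) ->
  exists2 sigma, states nB sigma &
    forall X, test_image G X -> v <= retr (sigma *m ptrace1 X).
Proof.
move=> sG nfeas; have [hG tG] := sG.
pose V : 'M[C]_nB := (v%:C)%:M; have hV : V ^t* = V by exact: adjmx_scalar.
pose Z1 := ptrace1 (G *t (1%:M : 'M[C]_nB)) - V.
pose f n (Z : 'M[C]_n) := retr (Z *m Z).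
(* The up-closure is unbounded, so only points no farther from v 1 than the one given by X = G (x) 1
   are kept. The first slot is pinned to G. *)
pose S G' X Z := [/\ G' = G, test_image G X, Z ^t* = Z,
  psd (Z + V - ptrace1 X) & f _ Z <= f _ Z1].
have cf (T : topologicalType) (Z : T -> 'M[C]_nB) :
    mxcont Z -> continuous (fun x => f _ (Z x)).
  by move=> cZ; apply: continuous_retr; exact: mxcontM.
have hZ1 : Z1 ^t* = Z1.
  by rewrite adjmxB hV adjmx_ptrace1// adjmx_tens adjmx1 (psd_herm hG).
have [] := @herm_min _ _ _ _ S (f nB) (nB%:R + (f _ Z1 + 1)).
- move=> T G' X Z cG cX cZ hG' hX hZ.
  rewrite (_ : [set x | _] = [set x | G' x = G] `&`
    [set x | test_image G (X x)] `&` [set x | psd (Z x + V - ptrace1 (X x))] `&`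
    [set x | f _ (Z x) <= f _ Z1]).
    apply: closedI; [apply: closedI; [apply: closedI|]|].
    + by apply: closed_mxcont_eq => //; exact: mxcont_cst.
    + apply: (@closed_test_image _ (fun=> G)) => // [|_]; first exact: mxcont_cst.
      exact: psd_herm.
    + apply: closed_psd => [x|].
        by rewrite adjmxB adjmxD adjmx_ptrace1// hV hZ.
      apply: mxcontB; last exact: mxcont_ptrace1.
      by apply: mxcontD => //; exact: mxcont_cst.
    + by apply: closed_ler; [exact: cf | move=> x; exact: cst_continuous].
  apply/seteqP; split => x.
    by move=> [h1 h2 h3 h4 h5]; exact: conj (conj (conj h1 h2) h4) h5.
  by move=> [[[h1 h2] h4] h5]; exact: And5 h1 h2 (hZ x) h4 h5.
- exact: cf.
- by move=> G' X Z [-> [hX _ _] hZ _ _]; split=> //; exact: psd_herm.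
- have n0 : 0 <= nB%:R :> R by rewrite ler0n.
  have n1 : 1 <= nB%:R :> R by rewrite ler1n.
  have f0 n (Z : 'M[C]_n) : Z ^t* = Z -> 0 <= f _ Z.
    move=> hZ; rewrite /f -[X in _ *m X]hZ.
    by have := psd_mxtrace (psd_gram Z); rewrite lecE => /andP[].
  have f1 := f0 _ _ hZ1.
  move=> G' X Z [-> hX hZ _ fZ]; split=> i j.
  + rewrite (le_trans (psd_entry_bound i j hG))// tG.
    by rewrite -[1]/(1%:C) lecR; lra.
  + by rewrite (le_trans (test_image_bound i j tG hX))// lecR; lra.
  + by rewrite (le_trans (herm_entry_bound i j hZ))// lecR -/(f _ Z); lra.
- exists G, (G *t 1%:M), Z1; split=> //; first exact: test_image_tens1.
  by rewrite subrK subrr; exact: psd0.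
move=> _ [X0 [Z0 [[_ tX0 hZ0 pZ0 fZ0] minZ0]]].
have min (X : 'M[C]_(nA * nB)) (Z : 'M[C]_nB) : test_image G X -> Z ^t* = Z ->
    psd (Z + V - ptrace1 X) -> f _ Z0 <= f _ Z.
  move=> tX hZ pZ; have [fZ|/ltW fZ] := leP (f _ Z) (f _ Z1).
    by apply: (minZ0 G X).
  exact: le_trans fZ0 fZ.
(* The variational inequality of the nearest point: by convexity the segment from Z0 to Z stays
   admissible, and along it the squared distance is quadratic in t. *)
have opt X Z : test_image G X -> Z ^t* = Z -> psd (Z + V - ptrace1 X) ->
    0 <= retr (Z0 *m (Z - Z0)).
  move=> tX hZ pZ.
  have step t : 0 <= t -> t <= 1 ->
      0 <= t * (2 * retr (Z0 *m (Z - Z0))) + t ^+ 2 * f _ (Z - Z0).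
    move=> t0 t1.
    have conv n (A B : 'M[C]_n) : A + t%:C *: (B - A) = (1 - t)%:C *: A + t%:C *: B.
      by rewrite rmorphB /= scalerBl scale1r scalerBr addrA addrAC.
    have t1' : 0 <= 1 - t by rewrite subr_ge0.
    have : f _ Z0 <= f _ (Z0 + t%:C *: (Z - Z0)).
      apply: (min (X0 + t%:C *: (X - X0))).
      + have [a1 a2 a3] := tX0; have [b1 b2 b3] := tX; split.
        * by rewrite conv; exact: psdD (psdZ t1' a1) (psdZ t0 b1).
        * rewrite (_ : _ - _ = (1 - t)%:C *: (G *t 1%:M - X0) +
            t%:C *: (G *t 1%:M - X)); first exact: psdD (psdZ t1' a2) (psdZ t0 b2).
          rewrite conv !scalerBr addrACA -scalerDl -rmorphD /= subrK scale1r.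
          by rewrite -opprD.
        * rewrite conv mulmxDl -!scalemxAl retrD !retrZ.
          by nra.
      + by rewrite adjmxD adjmxZ adjmxB hZ hZ0.
      + rewrite (_ : _ - _ = (1 - t)%:C *: (Z0 + V - ptrace1 X0) +
            t%:C *: (Z + V - ptrace1 X)); first exact: psdD (psdZ t1' pZ0) (psdZ t0 pZ).
        rewrite !conv ptrace1D !ptrace1Z !scalerBr !scalerDr opprD.
        rewrite [RHS]addrACA; congr (_ + _).
        by rewrite [RHS]addrACA -scalerDl -rmorphD /= subrK scale1r.
    rewrite /f mulmxDl !mulmxDr -!scalemxAl -!scalemxAr !retrD !retrZ.
    rewrite (_ : retr ((Z - Z0) *m Z0) = retr (Z0 *m (Z - Z0))); last first.
      by rewrite /retr mxtrace_mulC.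
    by move=> h; lra.
  rewrite leNgt; apply/negP => neg.
  set p := retr _ in neg step; set q := f _ _ in step.
  have q0 : 0 <= q by have := step 1 ler01 (lexx _); rewrite !mul1r expr1n mul1r; lra.
  (* Here p < 0 and q >= 0, so 0 < t <= 1, and t q = - p + t p yields 2 p + t q = p (1 + t) < 0,
     against [step]. *)
  pose t := - p / (q - p).
  have qp : 0 < q - p by lra.
  have t0 : 0 < t by rewrite divr_gt0//; lra.
  have t1 : t <= 1 by rewrite ler_pdivrMr//; lra.
  have e : t * (q - p) = - p by rewrite /t divfK// gt_eqF.
  have := step t (ltW t0) t1.
  rewrite expr2 -mulrA -mulrDr pmulr_rge0//.
  nra.
(* Adding any psd N to Z0 stays in the up-closure, so [opt] gives Tr Z0 N >= 0. *)
have psdZ0 : psd Z0.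
  apply: psd_retr_ge0 => // N hN.
  have := opt X0 (Z0 + N) tX0; rewrite [Z0 + N]addrC addrK; apply.
    by rewrite adjmxD hZ0 (psd_herm hN).
  by rewrite -addrA -addrA; apply: (psdD hN); rewrite addrA; exact: pZ0.
(* Apply [opt] to the displacement Tr_1 X - v 1 and discard Tr Z0^2 >= 0. *)
have sep X : test_image G X -> v * retr Z0 <= retr (Z0 *m ptrace1 X).
  move=> tX; have [hX _ _] := tX.
  have h : 0 <= retr (Z0 *m (ptrace1 X - V - Z0)).
    apply: (opt X _ tX); last by rewrite subrK subrr; exact: psd0.
    by rewrite adjmxB hV (adjmx_ptrace1 (psd_herm hX)).
  have := retr_psd_mul psdZ0 psdZ0.
  move: h; rewrite !mulmxBr !retrB mul_mx_scalar retrZ; lra.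
(* A zero displacement would mean v 1 >= Tr_1 X0, so that v itself would be feasible. *)
have Z0neq0 : \tr Z0 != 0.
  apply/eqP => /(psd_trace0 psdZ0) e; apply: (nfeas X0); split; first exact: tX0.
  by move: pZ0; rewrite e add0r.
have tZ0 : \tr Z0 = (retr Z0)%:C.
  by rewrite RRe_real// ger0_real// psd_mxtrace.
have r0 : 0 < retr Z0.
  rewrite -(ltcR) -tZ0 lt_neqAle eq_sym Z0neq0; exact: psd_mxtrace.
exists ((retr Z0)^-1%:C *: Z0).
  split; first by apply: psdZ => //; rewrite invr_ge0 ltW.
  by rewrite linearZ /= tZ0 -rmorphM /= mulVf ?gt_eqF.
move=> X tX; rewrite -scalemxAl retrZ mulrC ler_pdivlMr//.
exact: sep.
Qed.

End Program.

(** * Recovering a test from its sandwiched image *)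

Section Douglas.
Context {R : realType} {n : nat}.
Local Notation C := R[i].

(* On the range of S, S W = W S is the identity, and 0 <= X <= S^2 forces X to
   be supported there. *)
Lemma psd_sandwich (S W X : 'M[C]_n) : S ^t* = S -> W ^t* = W ->
  S *m W = W *m S -> S *m W *m S = S ->
  psd X -> psd (S *m S - X) ->
  S *m (W *m X *m W) *m S = X /\ psd (1%:M - W *m X *m W).
Proof.
move=> hS hW SWC SWS hX hSX.
(* N is the orthogonal projection onto the kernel of S; 0 <= NXN <= N S^2 N = 0 then forces XN =
   0. *)
have [N eN] : exists N : 'M[C]_n, N = 1%:M - S *m W by eexists.
have hN : N ^t* = N by rewrite eN adjmxB adjmx1 adjmx_mul hS hW -SWC.
have SN : S *m N = 0 by rewrite eN mulmxBr mulmx1 SWC mulmxA SWS subrr.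
have hNXN := psd_congr N hX.
have NXN : N *m X *m N = 0.
  rewrite hN in hNXN; apply: (psd_trace0 hNXN).
  apply/le_anti/andP; split; last exact: psd_mxtrace.
  have := psd_mxtrace (psd_congr N hSX).
  by rewrite hN mulmxBr mulmxBl -!mulmxA SN !mulmx0 sub0r linearN oppr_ge0.
have XN : X *m N = 0 by apply: psd_mul_eq0; rewrite ?hN.
have XP : X *m (S *m W) = X.
  by move/eqP: XN; rewrite eN mulmxBr mulmx1 subr_eq0 => /eqP <-.
have PX : S *m W *m X = X.
  have : (X *m (S *m W)) ^t* = X ^t* by rewrite XP.
  by rewrite !adjmx_mul hS hW (psd_herm hX) -SWC.
split; first by rewrite !mulmxA PX -mulmxA -SWC XP.
(* Since W S^2 W = SW, the remainder 1 - SW is N, and N = N N. *)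
rewrite (_ : _ - _ = W *m (S *m S - X) *m W + N *m N).
  apply: psdD; first by rewrite -{2}hW; exact: psd_congr.
  by rewrite -{2}hN; exact: psd_gram.
have -> : N *m N = N by rewrite {1}eN mulmxBl mul1mx SWC -mulmxA SN mulmx0 subr0.
by rewrite mulmxBr mulmxBl mulmxA -SWC SWS eN [RHS]addrC addrA subrK.
Qed.

End Douglas.

(** * The minimax identity *)

Section MinMax.
Context {R : realType} {nA nB : nat}.
Local Notation C := R[i].
Variable J : 'M[C]_(nA * nB).
Hypothesis mxtraceJ : forall G : 'M[C]_nA, psd G -> \tr ((G *t 1%:M) *m J) = \tr G.
Hypothesis nB_gt0 : (0 < nB)%N.
Variable eps : R.
Hypothesis eps_ge0 : 0 <= eps.

Lemma sup_inf_program (G : 'M[C]_nA) (lambda : R) : states nA G ->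
  is_minimum [set l | exists X, program J eps G X l] lambda ->
  sup [set inf [set retr (sigma *m ptrace1 X) | X in test_image J eps G]
      | sigma in states nB] = lambda.
Proof.
move=> sG [[X0 pX0] minl].
have lbd sigma : states nB sigma ->
    lbound [set retr (sigma *m ptrace1 X) | X in test_image J eps G] 0.
  move=> [hs _] _ [X [hX _ _] <-].
  exact: retr_psd_mul hs (psd_ptrace1 hX).
have [tX0 lX0] := pX0.
have ubd : ubound [set inf [set retr (sigma *m ptrace1 X) | X in test_image J eps G]
      | sigma in states nB] lambda.
  move=> _ [sigma ss <-]; apply: (@le_trans _ _ (retr (sigma *m ptrace1 X0))).
    apply: ge_inf; first by exists 0; exact: lbd.
    by exists X0.
  have [hs ts] := ss; have := retr_psd_mul hs lX0.
  by rewrite mulmxBr retrB mul_mx_scalar retrZ /retr ts mulr1 subr_ge0.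
(* Separation at -1, which is infeasible because feasible values are nonnegative, is used here just
   to produce some state, so that the supremum is over a nonempty set. *)
have [sigma0 ss0 _] : exists2 sigma, states nB sigma &
    forall X, test_image J eps G X -> -1 <= retr (sigma *m ptrace1 X).
  apply: (separating_state mxtraceJ) => // X pX.
  by have := program_ge0 nB_gt0 pX; rewrite ler0N1.
apply/le_anti/andP; split.
  by apply: ge_sup => //; eexists; exists sigma0.
rewrite leNgt; apply/negP => lt_sup; set s := sup _ in lt_sup.
pose v := (s + lambda) / 2.
have sv : s < v by rewrite /v; lra.
have vl : v < lambda by rewrite /v; lra.
have [sigma ss hs] : exists2 sigma, states nB sigma &
    forall X, test_image J eps G X -> v <= retr (sigma *m ptrace1 X).
  apply: (separating_state mxtraceJ) => // X pX.
  have : lambda <= v by apply: minl; exists X.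
  by rewrite leNgt vl.
have : v <= s.
  apply: (@le_trans _ _ (inf [set retr (sigma *m ptrace1 X) | X in test_image J eps G])).
    apply: lb_le_inf; first by exists (retr (sigma *m ptrace1 X0)), X0.
    by move=> _ [X tX <-]; exact: hs.
  by apply: ub_le_sup; [exists lambda | exists sigma].
by rewrite leNgt sv.
Qed.

End MinMax.

(** * From hypothesis tests of the channel to the program *)

Section Main.
Context {R : realType} {nA nB : nat}.
Local Notation C := R[i].
Variable E : {linear 'M[C]_nA -> 'M[C]_nB}.
Hypothesis E_tp : trace_preserving E.
Hypothesis nB_gt0 : (0 < nB)%N.
Variable eps : R.
Hypothesis eps_ge0 : 0 <= eps.

Local Notation J := (id_tens E (Phi nA)).

Lemma feasibleE G X l : feasible eps E G X l <-> program J eps G X l.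
Proof.
rewrite /feasible /loewner [X - 0]subr0; split.
  by move=> [_ [h1 h2 h3 h4]]; exact: conj (And3 h4 h3 h2) h1.
by move=> [[h4 h3 h2] h1]; exact: conj (proj1 h4) (And4 h1 h2 h3 h4).
Qed.

Lemma beta_ALL_test_image (rho : 'M[C]_nA) (sigma : 'M[C]_nB) : psd rho ->
  beta_ALL eps (id_tens E (purification rho)) (rho_copy rho *t sigma) =
  inf [set retr (sigma *m ptrace1 X) | X in test_image J eps (rho_copy rho)].
Proof.
move=> hrho; have [W [hW SWC SWS]] := sqrtmx_pinv hrho.
have hS := psd_sqrtmx hrho; have SS := sqrtmx_sqr hrho.
rewrite /beta_ALL rho_copyE// id_tens_purification.
move: (sqrtmx rho) hS SS SWC SWS => S hS SS SWC SWS.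
have KK : S^T *m S^T = rho^T by rewrite -trmx_mul SS.
have KL : S^T *m W^T = W^T *m S^T by rewrite -!trmx_mul SWC.
have KLK : S^T *m W^T *m S^T = S^T by rewrite -!trmx_mul mulmxA SWS.
(* K and L are the transposed square root and its transposed pseudo-inverse; from here on only the
   algebraic relations between them are kept. *)
move: (S^T) (W^T) (psd_tr hS) (psd_tr hW) KK KL KLK => K L hK hL KK KL KLK.
rewrite -KK.
have hKI := psd_herm (psd_tens hK (psd1 nB)).
have hLI := psd_herm (psd_tens hL (psd1 nB)).
have KIKI : (K *t 1%:M) *m (K *t 1%:M) = (K *m K) *t (1%:M : 'M[C]_nB).
  by rewrite mxtens.tensmx_mul mulmx1.
have KLCI : (K *t 1%:M) *m (L *t 1%:M) = (L *t 1%:M) *m (K *t (1%:M : 'M[C]_nB)).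
  by rewrite !mxtens.tensmx_mul KL.
have KLKI : (K *t 1%:M) *m (L *t 1%:M) *m (K *t 1%:M) = K *t (1%:M : 'M[C]_nB).
  by rewrite !mxtens.tensmx_mul KLK !mulmx1.
have sandwich (T : 'M[C]_(nA * nB)) :
    retr (((K *m K) *t sigma) *m T) =
    retr (sigma *m ptrace1 ((K *t 1%:M) *m T *m (K *t 1%:M))).
  by rewrite /retr mxtrace_tens_sandwich.
move: (K *t 1%:M) (L *t 1%:M) hKI hLI KIKI KLCI KLKI sandwich.
move=> KI LI hKI hLI KIKI KLCI KLKI sandwich.
(* Cyclicity carries the acceptance constraint from T to its image. *)
have trKJK (T : 'M[C]_(nA * nB)) :
    retr (KI *m J *m KI *m T) = retr (KI *m T *m KI *m J).
  by rewrite /retr -!mulmxA mxtrace_mulC -!mulmxA mxtrace_mulC -!mulmxA.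
congr inf; apply/seteqP; split => y /=.
  move=> [T [T0 T1 T2] <-]; exists (KI *m T *m KI).
    rewrite /loewner [T - 0]subr0 in T0; split.
    - by rewrite -{2}hKI; exact: psd_congr.
    - by have := psd_congr KI T1; rewrite hKI mulmxBr mulmxBl mulmx1 KIKI.
    - by rewrite -trKJK.
  exact/esym/sandwich.
move=> [X [X0 X1 X2] <-]; rewrite -KIKI in X1.
have [e hT] := psd_sandwich hKI hLI KLCI KLKI X0 X1.
exists (LI *m X *m LI); last by rewrite sandwich e.
split.
- by rewrite /loewner [_ - 0]subr0 -{2}hLI; exact: psd_congr.
- exact: hT.
- by rewrite trKJK e.
Qed.

Lemma neglog_anti (b x y : R) : 1 < b -> 0 <= x -> x <= y ->
  (neglog b y <= neglog b x)%E.
Proof.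
move=> b1 x0 xy; rewrite /neglog leeN2; apply: lee_wpmul2r.
  by rewrite lee_fin invr_ge0 ltW// ln_gt0.
rewrite lee_lne ?lee_fin// in_itv/= ?lee_fin ?leey ?andbT//.
exact: le_trans x0 xy.
Qed.

Lemma mxclosed_set1 n (G0 : 'M[C]_n) : mxclosed [set G0].
Proof. by move=> T G cG _; apply: closed_mxcont_eq => //; exact: mxcont_cst. Qed.

Lemma mxclosed_states n : mxclosed (states n : set 'M[C]_n).
Proof.
move=> T G cG hG; apply: closedI; first exact: closed_psd.
by apply: closed_ccont_eq; [exact: ccont_mxtrace | exact: ccont_cst].
Qed.

Lemma states_tr n (rho : 'M[C]_n) : states n rho -> states n rho^T.
Proof. by move=> [hr tr]; split; [exact: psd_tr | rewrite mxtrace_tr]. Qed.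

Lemma states_rho_copy n (rho : 'M[C]_n) : states n rho -> states n (rho_copy rho).
Proof. by move=> sr; rewrite rho_copyE; [exact: states_tr | case: sr]. Qed.

Lemma I_ALL_sdp_fixed b (rho : 'M[C]_nA) lambda : states nA rho ->
  is_minimum (sdp_fixed eps E (rho_copy rho)) lambda ->
  I_ALL b eps E rho = neglog b lambda.
Proof.
move=> sr ml; rewrite /I_ALL; congr neglog.
have mJ G := mxtrace_tens_choi (G := G) E_tp.
rewrite -(@sup_inf_program _ _ _ _ mJ nB_gt0 _ eps_ge0 _ lambda (states_rho_copy sr)).
  congr sup; apply: eq_imagel => sigma _.
  by apply: beta_ALL_test_image; case: sr.
rewrite (_ : [set l | _] = sdp_fixed eps E (rho_copy rho))//.
by apply/seteqP; split => l [X pX]; exists X; exact/feasibleE.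
Qed.

Lemma sdp_fixed_minimum (G : 'M[C]_nA) : states nA G ->
  exists lambda : R, is_minimum (sdp_fixed eps E G) lambda.
Proof.
move=> sG; have mJ G' := mxtrace_tens_choi (G := G') E_tp.
have [] := @sdp_minimum _ _ _ _ mJ nB_gt0 _ eps_ge0 _ (mxclosed_set1 (G0 := G)).
- by move=> _ ->.
- by exists G.
move=> l ml; exists l; move: ml; congr is_minimum.
apply/seteqP; split => k.
  by move=> [_ [X [-> pX]]]; exists X; exact/feasibleE.
by move=> [X pX]; exists G, X; split=> //; exact/feasibleE.
Qed.

Lemma states_neq0 n : (0 < n)%N -> (states n : set 'M[C]_n) !=set0.
Proof.
move=> n0; exists (diag_mx (\row_i (n%:R^-1))); split.
  by apply: psd_of_diag => i; rewrite mxE invr_ge0 ler0n.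
rewrite mxtrace_diag; under eq_bigr do rewrite mxE.
by rewrite sumr_const card_ord -[LHS]mulr_natl mulfV// pnatr_eq0 -lt0n.
Qed.

Lemma sdp_free_minimum : (0 < nA)%N ->
  exists lambda : R, is_minimum (sdp_free eps E) lambda.
Proof.
move=> nA_gt0; have mJ G' := mxtrace_tens_choi (G := G') E_tp.
have [] := @sdp_minimum _ _ _ _ mJ nB_gt0 _ eps_ge0 _ (@mxclosed_states nA) (fun _ => id).
  exact: states_neq0.
move=> l ml; exists l; move: ml; congr is_minimum.
apply/seteqP; split => k.
  move=> [G [X [[hG tG] pX]]]; exists G, X; rewrite /loewner [G - 0]subr0.
  by split=> //; exact/feasibleE.
move=> [G [X []]]; rewrite /loewner [G - 0]subr0 => hG tG pX.
by exists G, X; split; [exact: conj hG tG | exact/feasibleE].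
Qed.

End Main.

Theorem proposition24 (R : realType) (nA nB : nat) (nA_gt0 : (0 < nA)%N)
    (nB_gt0 : (0 < nB)%N)
    (E : {linear 'M[R[i]]_nA -> 'M[R[i]]_nB}) (E_cptp : cptp E)
    (b : R) (b_gt1 : 1 < b) (eps : R) (eps_ge0 : 0 <= eps) (eps_le1 : eps <= 1) :
  (forall rho : 'M[R[i]]_nA, states nA rho ->
     exists2 lambda : R, is_minimum (sdp_fixed eps E (rho_copy rho)) lambda
                       & I_ALL b eps E rho = neglog b lambda) /\
  (exists2 lambda : R, is_minimum (sdp_free eps E) lambda
     & is_maximum [set I_ALL b eps E rho | rho in states nA]
                  (neglog b lambda)).
Proof.
have [_ E_tp] := E_cptp; split.
  move=> rho sr.
  have [l ml] := sdp_fixed_minimum E_tp nB_gt0 eps_ge0 (states_rho_copy sr).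
  by exists l => //; exact: (I_ALL_sdp_fixed E_tp nB_gt0 eps_ge0).
have [l ml] := sdp_free_minimum E_tp nB_gt0 eps_ge0 nA_gt0.
exists l => //; have [[G [X [hG tG fX]]] minl] := ml.
rewrite /loewner [G - 0]subr0 in hG.
have sub rho : states nA rho ->
    sdp_fixed eps E (rho_copy rho) `<=` sdp_free eps E.
  move=> /states_rho_copy[hr tr] k [Y fY]; exists (rho_copy rho), Y.
  by rewrite /loewner [_ - 0]subr0.
(* Nonnegativity is what [neglog_anti] asks of its smaller argument. *)
have l0 : 0 <= l by move/feasibleE: fX; exact: program_ge0.
have sG : states nA G^T by apply: states_tr.
split.
  (* The maximiser is the transpose of the optimal G, whose copy is G again, so l is also optimal
     for the program fixed at that copy. *)
  exists G^T => //; apply: (I_ALL_sdp_fixed E_tp nB_gt0 eps_ge0) => //; split.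
    by exists X; rewrite (rho_copyE (psd_tr hG)) trmxK; exact: fX.
  by move=> k /(sub _ sG); exact: minl.
move=> _ [rho sr <-].
have [k mk] := sdp_fixed_minimum E_tp nB_gt0 eps_ge0 (states_rho_copy sr).
rewrite (I_ALL_sdp_fixed E_tp nB_gt0 eps_ge0 b sr mk).
by apply: neglog_anti => //; apply: minl; apply: (sub _ sr); case: mk.
Qed.
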